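(* Let $\boldsymbol{\pi}$ be a given instance and let $$\text{opt}=\min_{\mathbf{x}\in\mathcal{X}}\ \max_{\boldsymbol{\xi}\in\Xi}\ \min_{\mathbf{y}\in\mathcal{Y}}\left\{\mathbf{c}(\boldsymbol{\pi})^\top\mathbf{x}+\mathbf{d}(\boldsymbol{\xi},\boldsymbol{\pi})^\top\mathbf{y}\ :\ T(\boldsymbol{\xi},\boldsymbol{\pi})\mathbf{x}+W(\boldsymbol{\xi},\boldsymbol{\pi})\mathbf{y}\le\mathbf{h}(\boldsymbol{\xi},\boldsymbol{\pi})\right\}$$ be the optimal value of the two-stage robust problem. For $\mathbf{x}\in\mathcal{X}$ and $\boldsymbol{\xi}\in\Xi$ let $$\text{val}(\mathbf{x},\boldsymbol{\xi},\boldsymbol{\pi})=\min_{\mathbf{y}\in\mathcal{Y}}\left\{\mathbf{d}(\boldsymbol{\xi},\boldsymbol{\pi})^\top\mathbf{y}\ :\ W(\boldsymbol{\xi},\boldsymbol{\pi})\mathbf{y}\le\mathbf{h}(\boldsymbol{\xi},\boldsymbol{\pi})-T(\boldsymbol{\xi},\boldsymbol{\pi})\mathbf{x}\right\}.$$ Let $\varepsilon>0$ and $\alpha>0$, and assume: (a) the objective prediction network $\mathrm{NN}^O$ satisfies $\left|\mathrm{NN}^O(\boldsymbol{\pi},\mathbf{x},\boldsymbol{\xi})-\text{val}(\mathbf{x},\boldsymbol{\xi},\boldsymbol{\pi})\right|\le\alpha$ for all $\mathbf{x}\in\mathcal{X}$ and $\boldsymbol{\xi}\in\Xi$; (b) relatively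 complete recourse holds: for every $\mathbf{x}\in\mathcal{X}$ and every $\boldsymbol{\xi}\in\Xi$ there exists $\mathbf{y}\in\mathcal{Y}$ with $T(\boldsymbol{\xi},\boldsymbol{\pi})\mathbf{x}+W(\boldsymbol{\xi},\boldsymbol{\pi})\mathbf{y}\le\mathbf{h}(\boldsymbol{\xi},\boldsymbol{\pi})$. Then the solution $\mathbf{x}_{\mathrm{NN}}\in\mathcal{X}$ returned by the Neur2RO algorithm (described in the context), run with accuracy parameter $\varepsilon$, has objective value $$\mathbf{c}(\boldsymbol{\pi})^\top\mathbf{x}_{\mathrm{NN}}+\max_{\boldsymbol{\xi}\in\Xi}\ \text{val}(\mathbf{x}_{\mathrm{NN}},\boldsymbol{\xi},\boldsymbol{\pi})\ \le\ \text{opt}+2\alpha+\varepsilon.$$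
   Context: Setting. $\mathcal{X}\subset\mathbb{Z}^n$ and $\mathcal{Y}\subset\mathbb{Z}^m$ are the integer first-stage and second-stage decision sets, and $\Xi\subset\mathbb{R}^q$ is a convex and bounded uncertainty set. $\boldsymbol{\pi}$ is a fixed vector of certain (observed) instance parameters; $\mathbf{c}(\boldsymbol{\pi})\in\mathbb{R}^n$, $\mathbf{d}(\boldsymbol{\xi},\boldsymbol{\pi})\in\mathbb{R}^m$, $T(\boldsymbol{\xi},\boldsymbol{\pi})\in\mathbb{R}^{r\times n}$, $W(\boldsymbol{\xi},\boldsymbol{\pi})\in\mathbb{R}^{r\times m}$, $\mathbf{h}(\boldsymbol{\xi},\boldsymbol{\pi})\in\mathbb{R}^r$. It is assumed that some $\mathbf{x}\in\mathcal{X}$ has finite objective value. All minima and maxima written are understood to be attained. Network. $\mathrm{NN}^O(\boldsymbol{\pi},\mathbf{x},\boldsymbol{\xi})$ is a fixed real-valued function computed by a trained neural network with ReLU activations; it predicts $\text{val}(\mathbf{x},\boldsymbol{\xi},\boldsymbol{\pi})$. Algorithm (Neur2RO's learning-augmented column-and-constraint generation, in the form used under relatively complete recourse, where no feasibility prediction network is used). It maintains a finite set of scenarios $\Xi_O'\subset\Xi$, initialized as $\Xi_O'=\{\boldsymbol{\xi}\}$ for an arbitrary $\boldsymbol{\xi}\in\Xi$. Each iteration does the following. 1. (Main problem) Compute an optimal solution, with first-stage part $\mathbf{x}^\star$, of $$\min\ \mathbf{c}(\boldsymbol{\pi})^\top\mathbf{x}+\mathbf{d}(\boldsymbol{\xi}^{(a)},\boldsymbol{\pi})^\top\mathbf{y}\quad\text{over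 }\mathbf{x}\in\mathcal{X},\ \mathbf{y}\in\mathcal{Y},\ \boldsymbol{\xi}^{(a)}\in\Xi_O'$$ subject to $W(\boldsymbol{\xi}^{(a)},\boldsymbol{\pi})\mathbf{y}+T(\boldsymbol{\xi}^{(a)},\boldsymbol{\pi})\mathbf{x}\le\mathbf{h}(\boldsymbol{\xi}^{(a)},\boldsymbol{\pi})$ and $\boldsymbol{\xi}^{(a)}\in\arg\max_{\boldsymbol{\xi}\in\Xi_O'}\mathrm{NN}^O(\boldsymbol{\pi},\mathbf{x},\boldsymbol{\xi})$. 2. (Adversarial problem) Compute $\boldsymbol{\xi}_O\in\arg\max_{\boldsymbol{\xi}\in\Xi}\mathrm{NN}^O(\boldsymbol{\pi},\mathbf{x}^\star,\boldsymbol{\xi})$. 3. If $\mathrm{NN}^O(\boldsymbol{\pi},\mathbf{x}^\star,\boldsymbol{\xi}_O)\ge\max_{\boldsymbol{\xi}\in\Xi_O'}\mathrm{NN}^O(\boldsymbol{\pi},\mathbf{x}^\star,\boldsymbol{\xi})+\varepsilon$, replace $\Xi_O'$ by $\Xi_O'\cup\{\boldsymbol{\xi}_O\}$ and start the next iteration; otherwise terminate and return $\mathbf{x}_{\mathrm{NN}}=\mathbf{x}^\star$. *)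

(* Defs.v *)
(* MathComp / MathComp-Analysis *)
From HB Require Import structures.
From mathcomp Require Import all_boot all_order all_algebra.
From mathcomp Require Import all_classical all_reals all_analysis.

Set Implicit Arguments.
Unset Strict Implicit.
Unset Printing Implicit Defensive.

Import Order.TTheory GRing.Theory Num.Theory.
Import numFieldNormedType.Exports.

Local Open Scope classical_set_scope.
Local Open Scope ring_scope.

Definition intv {R : realType} {n : nat} (x : 'cV[int]_n) : 'cV[R]_n :=
  map_mx (fun z : int => z%:~R) x.

Definition dotp {R : realType} {n : nat} (u v : 'cV[R]_n) : R :=
  \sum_(i < n) u i 0 * v i 0.

Definition lev {R : realType} {r : nat} (u v : 'cV[R]_r) : Prop :=
  forall i, u i 0 <= v i 0.

Definition argmax {R : realType} {T : Type} (A : set T) (f : T -> R) : set T :=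
  [set a | A a /\ forall b, A b -> f b <= f a].

Definition argmin {R : realType} {T : Type} (A : set T) (f : T -> R) : set T :=
  [set a | A a /\ forall b, A b -> f a <= f b].

(* The infimum (supremum) of A belongs to A, i.e. it is a minimum (maximum). *)
Definition inf_attained {R : realType} (A : set (\bar R)) : Prop :=
  A (ereal_inf A).

Definition sup_attained {R : realType} (A : set (\bar R)) : Prop :=
  A (ereal_sup A).

(* Two-stage robust problems; every coefficient may depend on the vector of
   certain parameters (in R^p), and d, T, W, h also on the scenario (in R^q). *)
Record problem (R : realType) (n m p q r : nat) := Problem {
  fstX : set 'cV[int]_n;
  sndY : set 'cV[int]_m;
  Unc : set 'cV[R]_q;
  cobj : 'cV[R]_p -> 'cV[R]_n;
  dobj : 'cV[R]_q -> 'cV[R]_p -> 'cV[R]_m;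
  Tmat : 'cV[R]_q -> 'cV[R]_p -> 'M[R]_(r, n);
  Wmat : 'cV[R]_q -> 'cV[R]_p -> 'M[R]_(r, m);
  hvec : 'cV[R]_q -> 'cV[R]_p -> 'cV[R]_r
}.

Section TwoStage.
Context {R : realType} {n m p q r : nat}.
Variables (P : problem R n m p q r) (pi : 'cV[R]_p).

Definition cost1 (x : 'cV[int]_n) : R := dotp (cobj P pi) (intv x).

Definition cost2 (xi : 'cV[R]_q) (y : 'cV[int]_m) : R :=
  dotp (dobj P xi pi) (intv y).

Definition recourse (x : 'cV[int]_n) (xi : 'cV[R]_q) : set 'cV[int]_m :=
  [set y | sndY P y /\
    lev (Tmat P xi pi *m intv x + Wmat P xi pi *m intv y) (hvec P xi pi)].

Definition stage2_set (x : 'cV[int]_n) (xi : 'cV[R]_q) : set (\bar R) :=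
  [set (cost2 xi y)%:E | y in recourse x xi].

(* Values in \bar R: the value is +oo when no second-stage decision is feasible. *)
Definition stage2_val (x : 'cV[int]_n) (xi : 'cV[R]_q) : \bar R :=
  ereal_inf (stage2_set x xi).

Definition total_set (x : 'cV[int]_n) (xi : 'cV[R]_q) : set (\bar R) :=
  [set (cost1 x + cost2 xi y)%:E | y in recourse x xi].

Definition total_val (x : 'cV[int]_n) (xi : 'cV[R]_q) : \bar R :=
  ereal_inf (total_set x xi).

Definition robust_cost (x : 'cV[int]_n) : \bar R :=
  ereal_sup [set total_val x xi | xi in Unc P].

Definition opt_val : \bar R := ereal_inf [set robust_cost x | x in fstX P].

Definition extrema_attained : Prop :=
  [/\ forall x xi, fstX P x -> Unc P xi -> inf_attained (stage2_set x xi),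
      forall x xi, fstX P x -> Unc P xi -> inf_attained (total_set x xi),
      forall x, fstX P x -> sup_attained [set stage2_val x xi | xi in Unc P],
      forall x, fstX P x -> sup_attained [set total_val x xi | xi in Unc P] &
      inf_attained [set robust_cost x | x in fstX P]].

Definition relatively_complete_recourse : Prop :=
  forall x xi, fstX P x -> Unc P xi -> recourse x xi !=set0.

End TwoStage.

(* Feed-forward networks from R^i to R^o: affine layers of arbitrary widths,
   with a ReLU activation after every layer except the output one. *)
Inductive relu_net (R : Type) (o : nat) : nat -> Type :=
| Output (i : nat) (A : 'M[R]_(o, i)) (b : 'cV[R]_o) : relu_net R o i
| Hidden (i k : nat) (A : 'M[R]_(k, i)) (b : 'cV[R]_k) :
    relu_net R o k -> relu_net R o i.

Definition relu {R : realType} {k : nat} (u : 'cV[R]_k) : 'cV[R]_k :=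
  map_mx (fun t : R => Num.max t 0) u.

Fixpoint net_eval {R : realType} {o i : nat} (N : relu_net R o i) :
    'cV[R]_i -> 'cV[R]_o :=
  match N with
  | Output _ A b => fun u => A *m u + b
  | Hidden _ _ A b N' => fun u => net_eval N' (relu (A *m u + b))
  end.

(* The network reads the concatenation of pi, x and xi. *)
Definition nn_pred {R : realType} {n p q : nat} (N : relu_net R 1 (p + n + q))
    (pi : 'cV[R]_p) (x : 'cV[int]_n) (xi : 'cV[R]_q) : R :=
  net_eval N (col_mx (col_mx pi (intv x)) xi) 0 0.

Section Algorithm.
Context {R : realType} {n m p q r : nat}.
Variables (P : problem R n m p q r) (pi : 'cV[R]_p).
Variables (NN : 'cV[R]_p -> 'cV[int]_n -> 'cV[R]_q -> R) (eps : R).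

Definition main_feasible (S : set 'cV[R]_q) :
    set ('cV[int]_n * 'cV[int]_m * 'cV[R]_q) :=
  [set t | let: (x, y, xi) := t in
    [/\ fstX P x, S xi, recourse P pi x xi y & argmax S (NN pi x) xi]].

Definition main_objective (t : 'cV[int]_n * 'cV[int]_m * 'cV[R]_q) : R :=
  let: (x, y, xi) := t in cost1 P pi x + cost2 P pi xi y.

Definition main_solution (S : set 'cV[R]_q) (x : 'cV[int]_n) : Prop :=
  exists y xi, argmin (main_feasible S) main_objective (x, y, xi).

Definition max_pred (S : set 'cV[R]_q) (x : 'cV[int]_n) : R :=
  sup [set NN pi x xi | xi in S].

(* Scenario sets that some run of the algorithm can hold at the start of an
   iteration; they are finite and nonempty by construction. *)
Inductive scenario_set : set 'cV[R]_q -> Prop :=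
| scenario_init xi : Unc P xi -> scenario_set [set xi]
| scenario_add S x xiO :
    scenario_set S -> main_solution S x -> argmax (Unc P) (NN pi x) xiO ->
    max_pred S x + eps <= NN pi x xiO -> scenario_set (S `|` [set xiO]).

Definition returned (x : 'cV[int]_n) : Prop :=
  exists S xiO,
    [/\ scenario_set S, main_solution S x, argmax (Unc P) (NN pi x) xiO &
        ~ (max_pred S x + eps <= NN pi x xiO)].

End Algorithm.

(* Main.v *)
Require Import Defs.
From HB Require Import structures.
From mathcomp Require Import all_boot all_order all_algebra.
From mathcomp Require Import all_classical all_reals all_analysis.
Import Order.TTheory GRing.Theory Num.Theory.
Import numFieldNormedType.Exports.
Local Open Scope classical_set_scope.
Local Open Scope ring_scope.

(** Write [v x xi] for the second-stage value and [f] for the predictor, and let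
    [S] be the last scenario set, [(xs, ys, xia)] the last main solution. Two
    facts give the bound.

    - The value of the main problem is at most [opt]. For any first-stage [x],
      some scenario of [S] maximizes the prediction [f x], so [x] together with
      that scenario and any recourse decision is feasible there. The main optimum
      is thus at most the total cost of [x] under that one scenario, hence at
      most the robust cost of [x]
      ([main_value_le_robust_cost]).
    - The scenario [xia] is nearly a worst case for [xs]. The stopping test says
      that no scenario has a prediction [eps] or more above that of [xia]; going
      from [v] to [f] and back costs [alpha] each time, so
      [v xs xi <= v xs xia + 2 alpha + eps] for every [xi]
      ([returned_stage2_val_le]).

    As [v xs xia] is at most the cost of [ys], the second fact bounds the robust
    cost of [xs] by the main optimum plus [2 alpha + eps], and the first one
    bounds the main optimum by [opt]. The lemmas take as predictor an arbitrary
    function with the error bound [alpha]. *)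

Lemma ereal_dist_le {R : realType} {a e : R} {v : \bar R} :
  (`|a%:E - v| <= e%:E)%E -> ((a - e)%:E <= v)%E /\ (v <= (a + e)%:E)%E.
Proof.
case: v => [v| |] //; rewrite -EFinB abse_EFin !lee_fin ler_distl => /andP[h1 h2].
by split; [rewrite lerBlDr | rewrite -lerBlDr].
Qed.

Section Algorithm.
Context {R : realType} {n m p q r : nat}.
Variables (P : problem R n m p q r) (pi : 'cV[R]_p).
Variables (NN : 'cV[R]_p -> 'cV[int]_n -> 'cV[R]_q -> R) (eps : R).

Lemma scenario_set_sub {S} : scenario_set P pi NN eps S -> S `<=` Unc P.
Proof.
elim=> [xi Pxi _ -> //|{}S x xiO _ IH _ [PxiO _] _ xi [/IH //|-> //]].
Qed.

(** Finiteness of scenario sets enters here, through their inductive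
    construction: each added scenario either beats the previous maximizer or
    leaves it in place. *)
Lemma scenario_set_argmax {S} (f : 'cV[R]_q -> R) :
  scenario_set P pi NN eps S -> exists xi, argmax S f xi.
Proof.
elim=> [xi _|{}S x xiO _ [a [Sa amax]] _ _ _].
  by exists xi; split=> // b ->.
have [le_Oa|lt_aO] := leP (f xiO) (f a).
  by exists a; split; [left|move=> b [/amax //|-> //]].
exists xiO; split; [by right|move=> b [/amax le_ba|-> //]].
exact: le_trans le_ba (ltW lt_aO).
Qed.

Lemma max_pred_le {S x xi} : argmax S (NN pi x) xi -> max_pred pi NN S x <= NN pi x xi.
Proof.
move=> [Sxi ximax]; apply: ge_sup; first by exists (NN pi x xi), xi.
by move=> _ [b Sb <-]; exact: ximax.
Qed.

(** The main problem is a relaxation: [x] is feasible for it with the scenario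
    that the predictor ranks worst in [S], and that scenario is only one of those
    over which the robust cost is a supremum. *)
Lemma main_value_le_robust_cost {S t x} :
  scenario_set P pi NN eps S ->
  argmin (main_feasible P pi NN S) (main_objective P pi) t ->
  fstX P x -> ((main_objective P pi t)%:E <= robust_cost P pi x)%E.
Proof.
move=> scS [_ tmin] Xx.
have [xi xiP] := scenario_set_argmax (NN pi x) scS.
apply: (@le_trans _ _ (total_val P pi x xi)).
  apply: le_ereal_inf_tmp => _ [y recy <-]; rewrite lee_fin.
  by apply: (tmin (x, y, xi)); split=> //; case: xiP.
apply: ereal_sup_ubound; exists xi => //.
by apply: (scenario_set_sub scS); case: xiP.
Qed.

Variable alpha : R.
Hypothesis NN_error : forall x xi, fstX P x -> Unc P xi ->
  (`|(NN pi x xi)%:E - stage2_val P pi x xi| <= alpha%:E)%E.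

(** When the algorithm stops, the scenario chosen by the main problem is
    a worst case up to the tolerance and two prediction errors. The
    comparison is with the cost of a recourse decision [y], which dominates the
    second-stage value under [xia], because the main objective contains that cost. *)
Lemma returned_stage2_val_le {S x y xia xiO xi} :
  fstX P x -> Unc P xia -> recourse P pi x xia y ->
  argmax S (NN pi x) xia -> argmax (Unc P) (NN pi x) xiO ->
  ~ (max_pred pi NN S x + eps <= NN pi x xiO) -> Unc P xi ->
  (stage2_val P pi x xi <= (cost2 P pi xia y + (2 * alpha + eps))%:E)%E.
Proof.
move=> Xx Uxia recy xiamax [_ xiOmax] /negP; rewrite -ltNge => stop Uxi.
have [_ v_le] := ereal_dist_le (NN_error _ _ Xx Uxi).
have [le_v _] := ereal_dist_le (NN_error _ _ Xx Uxia).
have : ((NN pi x xia - alpha)%:E <= (cost2 P pi xia y)%:E)%E.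
  by apply: le_trans le_v _; apply: ereal_inf_lbound; exists y.
rewrite lee_fin lerBlDr => NN_le.
apply: le_trans v_le _; rewrite lee_fin.
have -> : cost2 P pi xia y + (2 * alpha + eps)
    = cost2 P pi xia y + alpha + eps + alpha.
  by rewrite mulr_natl mulr2n !addrA -!(addrAC _ eps).
rewrite lerD2r (le_trans (xiOmax _ Uxi)) // (le_trans (ltW stop)) // lerD2r.
exact: le_trans (max_pred_le xiamax) NN_le.
Qed.

Lemma returned_near_optimal {x} : returned P pi NN eps x ->
  fstX P x /\
  ((cost1 P pi x)%:E + ereal_sup [set stage2_val P pi x xi | xi in Unc P]
     <= opt_val P pi + (2 * alpha + eps)%:E)%E.
Proof.
move=> [S [xiO [scS [y [xia tmin]] xiOmax stop]]].
have [[Xx Sxia recy xiamax] _] := tmin.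
split=> //; rewrite -leeBlDr //; apply: le_ereal_inf_tmp => _ [x' Xx' <-].
apply: le_trans (main_value_le_robust_cost scS tmin Xx'); rewrite leeBlDr //=.
rewrite -EFinD -addrA EFinD leeD2l //; apply: ge_ereal_sup => _ [xi Uxi <-].
by apply: returned_stage2_val_le xiOmax stop Uxi => //; exact: (scenario_set_sub scS).
Qed.

End Algorithm.

Theorem theorem2 (R : realType) (n m p q r : nat)
    (P : problem R n m p q r) (pi : 'cV[R]_p)
    (N : relu_net R 1 (p + n + q)) (eps alpha : R)
    (Unc_convex : convex_set (Unc P))
    (Unc_bounded : bounded_set (Unc P))
    (finite_obj : exists2 x, fstX P x & robust_cost P pi x \is a fin_num)
    (attained : extrema_attained P pi)
    (eps_gt0 : 0 < eps) (alpha_gt0 : 0 < alpha)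
    (NN_error : forall x xi, fstX P x -> Unc P xi ->
       (`|(nn_pred N pi x xi)%:E - stage2_val P pi x xi| <= alpha%:E)%E)
    (rcr : relatively_complete_recourse P pi)
    (xNN : 'cV[int]_n) (xNN_returned : returned P pi (nn_pred N) eps xNN) :
  fstX P xNN /\
  ((cost1 P pi xNN)%:E + ereal_sup [set stage2_val P pi xNN xi | xi in Unc P]
     <= opt_val P pi + (2 * alpha + eps)%:E)%E.
Proof.
exact: (returned_near_optimal P pi (nn_pred N) eps alpha NN_error xNN_returned).
Qed.
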